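(* Let $F$ be a number field of degree $n$ with discriminant $\Delta_F$, let $\gamma_n$ be the Hermite constant in dimension $n$, and let $c_n=\left(\frac{n}{\gamma_n}\right)^n$. Let $I$ be a fractional ideal of $F$ containing $1$. If $N(I^{-1})>\sqrt{|\Delta_F|/c_n}$, then $I$ is not $1$-reduced.
   Context: $N(I^{-1})$ denotes the (absolute) norm of the fractional ideal $I^{-1}$. The Hermite constant $\gamma_n$ is the smallest real number such that every full-rank lattice $L$ in an $n$-dimensional Euclidean space contains a nonzero vector $x$ with $\|x\|^2\le\gamma_n\,\mathrm{covol}(L)^{2/n}$. Let $F$ have $r_1$ real embeddings $\sigma_1,\dots,\sigma_{r_1}$ and $r_2$ complex embeddings up to conjugation $\sigma_{r_1+1},\dots,\sigma_{r_1+r_2}$, so $n=r_1+2r_2$. For $u=(u_i)\in(\mathbb{R}_{>0})^{r_1+r_2}$ and $g\in F$ define $\|g\|_u\ge 0$ by $$\|g\|_u^2=\sum_{i=1}^{r_1}u_i^2|\sigma_i(g)|^2+2\sum_{i=r_1+1}^{r_1+r_2}u_i^2|\sigma_i(g)|^2.$$ The element $1$ is called primitive in $I$ if $1\in I$ and $1$ is not divisible in $I$ by any integer $d\ge2$ (i.e. $1/d\notin I$ for all integers $d\ge 2$). A fractional ideal $I$ is called $1$-reduced if $1$ is primitive in $I$ and there exists $u\in(\mathbb{R}_{>0})^{r_1+r_2}$ such that $\|1\|_u\le\|g\|_u$ for all $g\in I\setminus\{0\}$. *)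

(* Defs.v *)
From HB Require Import structures.
From mathcomp Require Import all_boot all_order all_algebra all_field.
From mathcomp Require Import all_classical all_reals exp.
From mathcomp Require Import complex.

Set Implicit Arguments.
Unset Strict Implicit.
Unset Printing Implicit Defensive.

Import Order.TTheory GRing.Theory Num.Theory.
Local Open Scope classical_set_scope.
Local Open Scope ring_scope.

(* A number field is a finite extension F : fieldExtType rat; its degree is
   \dim {:F}.  Subrings and (fractional) ideals are sets of elements of F. *)

Section NumberField.
Variable F : fieldExtType rat.

Definition ring_of_integers : set F :=
  [set x | integralOver (intr : int -> F) x].

Definition integral_basis (b : (\dim {:F}).-tuple F) : Prop :=
  basis_of {:F} b /\
  ring_of_integers =
    [set x | exists z : 'I_(\dim {:F}) -> int,
        x = \sum_(i < \dim {:F}) b`_i *~ z i].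

(* The trace of the Q-linear map y |-> x * y of F. *)
Definition field_trace (x : F) : rat :=
  \sum_(i < \dim {:F}) coord (vbasis {:F}) i (x * (vbasis {:F})`_i).

Definition basis_discriminant (b : (\dim {:F}).-tuple F) : rat :=
  \det (\matrix_(i < \dim {:F}, j < \dim {:F}) field_trace (b`_i * b`_j)).

(* The value does not depend on the integral basis, so the choice made by xget
   is immaterial (and its default value 0 is never used). *)
Definition field_discriminant : rat :=
  xget 0 [set basis_discriminant b | b in integral_basis].

Definition fractional_ideal (I : set F) : Prop :=
  [/\ exists2 x, I x & x != 0,
      forall x y, I x -> I y -> I (x + y),
      forall a x, ring_of_integers a -> I x -> I (a * x) &
      exists2 d, ring_of_integers d /\ d != 0 &
        forall x, I x -> ring_of_integers (d * x)].

Definition ideal_inv (I : set F) : set F :=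
  [set x | forall y, I y -> ring_of_integers (x * y)].

(* [A : B] = k, for additive subgroups B `<=` A of F: the r i are a complete
   system of representatives of A / B. *)
Definition has_index (A B : set F) (k : nat) : Prop :=
  B `<=` A /\
  exists r : 'I_k -> F,
    (forall i, A (r i)) /\ (forall x, A x -> exists! i, B (x - r i)).

(* N(J) = [O_F : d J] / d ^ n for any integer d > 0 such that d J is contained
   in O_F; the quotient does not depend on d. *)
Definition ideal_norm (J : set F) : rat :=
  xget 0 [set q | exists d k : nat,
    [/\ (0 < d)%N,
        has_index ring_of_integers [set d%:R * x | x in J] k &
        q = k%:R / d%:R ^+ \dim {:F}]].

Definition primitive_one (I : set F) : Prop :=
  I 1 /\ forall d : nat, (2 <= d)%N -> ~ I (d%:R^-1).

End NumberField.

(* The rows of the invertible matrix B are a basis of the lattice. *)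
Definition lattice (R : realType) (n : nat) (B : 'M[R]_n) : set 'rV[R]_n :=
  [set x | exists z : 'rV[int]_n, x = map_mx intr z *m B].

Definition hermite_bound (R : realType) (n : nat) : set R :=
  [set g | forall B : 'M[R]_n, B \in unitmx ->
     exists x : 'rV[R]_n,
       [/\ lattice B x, x != 0 &
           \sum_j x 0 j ^+ 2 <= g * `|\det B| `^ (2 / n%:R)]].

Arguments hermite_bound : clear implicits.

(* For n >= 1 this infimum is attained: it is the smallest Hermite bound. *)
Definition hermite_constant (R : realType) (n : nat) : R :=
  inf (hermite_bound R n).

Section Embeddings.
Variables (R : realType) (F : fieldExtType rat) (r1 r2 : nat).
Variable sigma : 'I_(r1 + r2) -> {rmorphism F -> R[i]}.

(* The first r1 of the sigma i are the real embeddings of F, the last r2 are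
   representatives of the non-real embeddings up to complex conjugation. *)
Definition embeddings_up_to_conj : Prop :=
  [/\ forall (i : 'I_r1) x, complex.Im (sigma (lshift r2 i) x) = 0,
      forall i : 'I_r2, exists x, complex.Im (sigma (rshift r1 i) x) != 0,
      forall i j, sigma i =1 sigma j \/ sigma i =1 (fun x => conjc (sigma j x)) ->
        i = j &
      forall tau : {rmorphism F -> R[i]}, exists i,
        tau =1 sigma i \/ tau =1 (fun x => conjc (sigma i x))].

Definition unorm (u : 'I_(r1 + r2) -> R) (g : F) : R :=
  Num.sqrt
    (\sum_(i < r1) u (lshift r2 i) ^+ 2 * Normc.normc (sigma (lshift r2 i) g) ^+ 2 +
     2 * \sum_(i < r2)
           u (rshift r1 i) ^+ 2 * Normc.normc (sigma (rshift r1 i) g) ^+ 2).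

Definition one_reduced (I : set F) : Prop :=
  primitive_one I /\
  exists2 u : 'I_(r1 + r2) -> R,
    forall i, 0 < u i &
    forall g, I g -> g != 0 -> unorm u 1 <= unorm u g.

End Embeddings.

(* Main.v *)
Require Import Defs.
From HB Require Import structures.
From mathcomp Require Import all_boot all_order all_algebra all_field.
From mathcomp Require Import all_classical all_reals exp.
From mathcomp Require Import complex.
From mathcomp Require Import zify ring lra.

Set Implicit Arguments.
Unset Strict Implicit.
Unset Printing Implicit Defensive.

Import Order.TTheory GRing.Theory Num.Theory.
Local Open Scope classical_set_scope.
Local Open Scope ring_scope.

(** Let [O] be the ring of integers, [n] the degree, and suppose that [1] is a
shortest vector of [I] for [||.||_u]. With [u_tau] the weight of the embedding
[tau] (conjugate embeddings have equal weights), [S = ||1||_u ^ 2] is the sum of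
the [n] numbers [u_tau ^ 2], so the inequality between arithmetic and geometric
means bounds their product [P] by [(S / n) ^ n]. On the other hand [S] is the
minimum of the lattice [I], hence at most [gamma_n covol ^ (2 / n)]. If [e] is a
[Z]-basis of [I], then [covol ^ 2 = P |disc e|] ([det_lattice_mx]) and
[Delta_F = m ^ 2 disc e], where [m] is the index of [O] in [I]. The product [P]
cancels, leaving [m <= sqrt (|Delta_F| / c_n)] ([index_bound]).

It remains to compare [m] with [N (I^-1)], which, as [1] lies in [I], is the
index of [I^-1] in [O], and to show [N (I^-1) <= m] ([ideal_inv_covering]). Climb
from [O] to [I] by submodules [J], each step [J < J + O x] having a simple quotient
[O / p]. Multiplication by [x] embeds [J^-1 / (J + O x)^-1] into [p^-1 / O], so
the step enlarges the index of [J^-1] in [O] by at most the index of [O] in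
[p^-1], and that of [O] in [J] by exactly the index of [p] in [O]. The former is
at most the latter: for a maximal ideal [p] of [O] the group [p^-1 / O] is cyclic
over [O / p], because [O] is integrally closed.

Three classical facts support the argument. [I] and [O] have [Z]-bases: a
rational basis in the module whose discriminant is minimal in absolute value is
one ([subgroup_zspan]). The discriminant is the squared determinant of the
conjugates of the basis ([ratr_basis_discriminant]), which rests on there being
exactly [n] embeddings ([card_embeddings]). Finally the infimum defining the
Hermite constant is taken over a nonempty set ([hermite_bound_nonempty]), which
is Minkowski's theorem with a crude constant. *)

(** * Cosets of subgroups *)

Definition subgroup (V : zmodType) (B : set V) :=
  B 0 /\ forall x y, B x -> B y -> B (x - y).

(** Indices are compared through packings, which bound them from below, and
coverings, which bound them from above. *)
Definition packing (V : zmodType) (A B : set V) (T : finType) (r : T -> V) :=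
  (forall i, A (r i)) /\ forall i j, B (r i - r j) -> i = j.

Definition covering (V : zmodType) (A B : set V) (T : finType) (r : T -> V) :=
  forall x, A x -> exists i, B (x - r i).

Section Cosets.
Variable V : zmodType.
Implicit Types (A B C : set V) (T : finType).

Lemma subgroupN B x : subgroup B -> B x -> B (- x).
Proof. by move=> [B0 BB] Bx; rewrite -sub0r; apply: BB. Qed.

Lemma subgroupD B x y : subgroup B -> B x -> B y -> B (x + y).
Proof. by move=> sB Bx By; rewrite -(opprK y); apply: sB.2 => //; apply: subgroupN. Qed.

Lemma subgroup_sum B T (f : T -> V) :
  subgroup B -> (forall i, B (f i)) -> B (\sum_i f i).
Proof.
move=> sB Bf; apply: (big_ind B) => //; first exact: sB.1.
by move=> x y; apply: subgroupD.
Qed.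

Lemma subgroupMz B x (z : int) : subgroup B -> B x -> B (x *~ z).
Proof.
move=> sB Bx; have Bn n : B (x *+ n).
  elim: n => [|n IH]; rewrite ?mulr0n ?mulrS; first exact: sB.1.
  exact: subgroupD.
by case: z => n; rewrite ?NegzE ?mulrNz; [|apply: subgroupN => //]; exact: Bn.
Qed.

Lemma subgroup_sub B x y z : subgroup B -> B (x - y) -> B (z - y) -> B (x - z).
Proof. by move=> sB Bxy /(sB.2 _ _ Bxy); rewrite opprB addrA subrK. Qed.

Lemma packing_le_covering A B T T' (r : T -> V) (r' : T' -> V) :
  subgroup B -> packing A B r -> covering A B r' -> (#|T| <= #|T'|)%N.
Proof.
move=> sB [Ar injr] cov.
have /choice [f fP] : forall i, exists j, B (r i - r' j) by move=> i; apply/cov/Ar.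
apply: (leq_card f) => i j eq_f; apply: injr.
by apply: subgroup_sub sB (fP i) _; rewrite eq_f; apply: fP.
Qed.

Lemma packing_option A B T (r : T -> V) x :
  subgroup B -> packing A B r -> A x -> (forall i, ~ B (x - r i)) ->
  packing A B (fun o : option T => if o is Some i then r i else x).
Proof.
move=> sB [Ar injr] Ax nBx; split=> [[i|] //|[i|] [j|] //= Bij].
- by rewrite (injr _ _ Bij).
- by case: (nBx i); rewrite -opprB; apply: subgroupN.
- by case: (nBx j).
Qed.

(** Otherwise one more coset could be added, and the packing would outnumber the
covering. *)
Lemma packing_covering A B T T' (r : T -> V) (r' : T' -> V) :
  subgroup B -> packing A B r -> covering A B r' -> (#|T'| <= #|T|)%N ->
  covering A B r.
Proof.
move=> sB pr cr' leT x Ax; apply: contrapT => /forallNP nBx.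
have := packing_le_covering sB (packing_option sB pr Ax nBx) cr'.
by rewrite card_option ltnNge leT.
Qed.

(** A packing of maximal cardinality is a complete system of representatives. *)
Lemma exists_packing_covering A B T (r : T -> V) :
  subgroup B -> covering A B r ->
  exists (k : nat) (s : 'I_k -> V), packing A B s /\ covering A B s.
Proof.
move=> sB cr.
pose P k := `[< exists s : 'I_k -> V, packing A B s >].
have P0 : exists k, P k.
  by exists 0%N; apply/asboolP; exists (fun=> 0); split => [[]|[]].
have Pbound k : P k -> (k <= #|T|)%N.
  move=> /asboolP [s sP]; rewrite -(card_ord k).
  exact: packing_le_covering sP cr.
case: (ex_maxnP P0 Pbound) => k /asboolP [s sP] maxk.
exists k, s; split=> // x Ax; apply: contrapT => /forallNP nBx.
suff /maxk : P k.+1 by rewrite ltnn.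
have [Ao injo] := packing_option sB sP Ax nBx.
have cardo : #|{: option 'I_k}| = k.+1 by rewrite card_option card_ord.
apply/asboolP; exists (fun i =>
  if enum_val (cast_ord (esym cardo) i) is Some j then s j else x).
by split=> [i|i j /injo /enum_val_inj /cast_ord_inj]; first exact: Ao.
Qed.

Lemma packing_mul A B C T T' (r : T -> V) (s : T' -> V) :
  subgroup A -> subgroup B -> B `<=` A -> C `<=` B ->
  packing A B r -> packing B C s ->
  packing A C (fun p : T * T' => r p.1 + s p.2).
Proof.
move=> sA sB BA CB [Ar injr] [Bs injs]; split=> [[i j]|[i j] [i' j'] /= Cd].
  by apply: subgroupD sA (Ar i) _; apply/BA/Bs.
have eq_i : i = i'.
  apply: injr; have := subgroupD sB (CB _ Cd) (sB.2 _ _ (Bs j') (Bs j)).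
  by rewrite -(opprB (s j)) opprD addrACA addrK.
rewrite eq_i in Cd *; congr pair; apply: injs.
by move: Cd; rewrite opprD addrACA subrr add0r.
Qed.

Lemma covering_mul A B C T T' (r : T -> V) (s : T' -> V) :
  covering A B r -> covering B C s ->
  covering A C (fun p : T * T' => r p.1 + s p.2).
Proof.
move=> cr cs x /cr [i /cs [j Cx]]; exists (i, j) => /=.
by rewrite opprD addrA.
Qed.

End Cosets.

(** A homomorphism that reflects [B'] into [B] embeds [A / B] into [A' / B'], so
that coset representatives can be pulled back. *)
Lemma covering_preim (V V' : zmodType) (f : V -> V') (A B : set V)
    (A' B' : set V') (T : finType) (r : T -> V') :
  subgroup B' -> {morph f : x y / x - y} ->
  (forall x, A x -> A' (f x)) ->
  (forall x y, A x -> A y -> B' (f (x - y)) -> B (x - y)) ->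
  covering A' B' r -> exists s : T -> V, covering A B s.
Proof.
move=> sB' fBE fA fB cr.
have /choice [s sP] : forall i, exists y,
    (exists x, A x /\ B' (f x - r i)) -> A y /\ B' (f y - r i).
  move=> i; case: (pselect (exists x, A x /\ B' (f x - r i))) => [[x xP]|nx].
    by exists x.
  by exists 0.
exists s => x Ax; have [i Bi] := cr _ (fA _ Ax); exists i.
have [Asi Bsi] : A (s i) /\ B' (f (s i) - r i) by apply: sP; exists x.
by apply: fB => //; rewrite fBE; apply: subgroup_sub sB' Bi Bsi.
Qed.

(** * Integer lattices and the Hermite constant *)

Definition row_lattice n (M : 'M[int]_n) : set 'rV[int]_n :=
  [set x | exists z, x = z *m M].

Lemma row_lattice_subgroup n (M : 'M[int]_n) : subgroup (row_lattice M).
Proof.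
split; first by exists 0; rewrite mul0mx.
by move=> x y [z ->] [t ->]; exists (z - t); rewrite mulmxBl.
Qed.

(** The Smith normal form [M = L D R] reduces the quotient of [Z ^ n] by the
rows of [M] to the product of the cyclic groups [Z / d_i]. *)
Lemma row_lattice_covering n (M : 'M[int]_n) : \det M != 0 ->
  exists (T : finType) (r : T -> 'rV[int]_n),
    #|T| = `|\det M|%N /\ covering setT (row_lattice M) r.
Proof.
have [L uL [U uU [d _ ->]]] := int_Smith_normal_form M.
set D := (\matrix_(i, j) _).
have DE : D = diag_mx (\row_i d`_i).
  by apply/matrixP => i j; rewrite !mxE.
rewrite !det_mulmx => det0.
have det_unit (N : 'M[int]_n) : N \in unitmx -> `|\det N|%N = 1%N.
  by rewrite unitmxE => /orP [] /eqP ->.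
have d0 i : (i < n)%N -> d`_i != 0.
  move=> lt_in; move: det0; rewrite DE det_diag !mulf_eq0 !negb_or.
  case/andP=> /andP [_ /prodf_neq0 /(_ (Ordinal lt_in) isT)].
  by rewrite !mxE.
pose T := {dffun forall i : 'I_n, 'I_(absz d`_i)}.
exists T, (fun f : T => (\row_i (f i : nat)%:Z) *m U); split.
  rewrite card_dep_ffun foldrE big_map big_enum /= !abszM.
  rewrite (det_unit L) // (det_unit U) // muln1 mul1n.
  rewrite DE det_diag (big_morph absz abszM (erefl _)); 
  by apply: eq_bigr => i _; rewrite mxE card_ord.
move=> x _; pose w i := (x *m invmx U) 0 i.
have xU : x *m invmx U = \row_i w i by apply/rowP => i; rewrite mxE.
have wlt i : (absz (w i %% d`_i)%Z < absz (d`_i)%R)%N.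
  by rewrite -ltz_nat gez0_abs ?modz_ge0 ?ltz_mod ?d0.
exists [ffun i => Ordinal (wlt i)] => /=.
exists ((\row_i (w i %/ d`_i)%Z) *m invmx L).
rewrite !mulmxA mulmxKV // -[x in LHS](mulmxKV uU) xU -mulmxBl; congr (_ *m _).
clearbody w; apply/rowP => i.
rewrite DE mul_mx_diag !mxE ffunE /= gez0_abs ?modz_ge0 ?d0 //.
by rewrite {1}(divz_eq (w i) d`_i) addrK.
Qed.

(** If [A] is singular, take a vector of its kernel. Otherwise two points of the
cube [{0, ..., s} ^ n] are congruent modulo the lattice, since it has fewer cosets
than the cube has points. *)
Lemma int_minkowski n (A : 'M[int]_n) (s : nat) : (`|\det A| < s.+1 ^ n)%N ->
  exists2 z : 'rV[int]_n, z != 0 & forall k, `|(z *m A) 0 k| <= s%:Z.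
Proof.
move=> lt_det; have [/eqP/det0P [z z0 zA0]|det0] := eqVneq (\det A) 0.
  by exists z => // k; rewrite zA0 mxE normr0.
have [T [r [cardT cov]]] := row_lattice_covering det0.
pose f (g : {ffun 'I_n -> 'I_s.+1}) : 'rV[int]_n := \row_i (g i : nat)%:Z.
have : ~ packing setT (row_lattice A) f.
  move=> pf; have := packing_le_covering (row_lattice_subgroup A) pf cov.
  by rewrite card_ffun !card_ord cardT leqNgt lt_det.
move/not_andP => [[]//|/existsNP [g /existsNP [g' /not_implyP [[z zE] neq]]]].
exists z => [|k].
  apply/eqP => z0; apply: neq; apply/ffunP => i; apply/val_inj/eqP.
  move/rowP/(_ i)/eqP: zE; rewrite z0 mul0mx !mxE subr_eq0 eqz_nat //.
rewrite -zE !mxE ler_norml; have := ltn_ord (g k); have := ltn_ord (g' k).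
move: (g k : nat) (g' k : nat) => a b; lia.
Qed.

Lemma normr_det_le (R : realDomainType) n (A : 'M[R]_n) (c : R) :
  (forall i j, `|A i j| <= c) -> `|\det A| <= n`!%:R * c ^+ n.
Proof.
move=> Ac; apply: le_trans (ler_norm_sum _ _ _) _.
rewrite -perm.card_Sn mulr_natl -sumr_const; apply: ler_sum => s _.
rewrite normrM normrX normrN1 expr1n mul1r normr_prod.
rewrite -[n in c ^+ n]card_ord -prodr_const; apply: ler_prod => i _.
by rewrite normr_ge0 Ac.
Qed.

(** A large multiple of the real lattice is rounded to an integer lattice, whose
determinant and short vectors are close to those of the multiple. *)
Lemma hermite_bound_nonempty (R : realType) n : (0 < n)%N ->
  hermite_bound R n !=set0.
Proof.
move=> n_gt0; pose C : R := (4 * n * n`!)%:R; exists (C ^+ 2) => B uB.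
have D_gt0 : 0 < `|\det B| by rewrite normr_gt0 -unitfE -unitmxE.
pose h := `|\det B| `^ n%:R^-1.
have h_ge0 : 0 <= h by apply: powR_ge0.
have hn : h ^+ n = `|\det B|.
  by rewrite -powR_mulrn // -powRrM mulVf ?powRr1 // pnatr_eq0 -lt0n.
pose V := invmx B.
pose K : R := \sum_i \sum_j `|V i j|.
have K_ge0 : 0 <= K by do 2!apply: sumr_ge0 => ? _.
have VrowK i : \sum_j `|V i j| <= K.
  by rewrite [leRHS](bigD1 i) //= lerDl; do 2!apply: sumr_ge0 => ? _.
have VK i j : `|V i j| <= K.
  apply: le_trans (VrowK i); rewrite (bigD1 j) //= lerDl.
  by apply: sumr_ge0 => ? _.
(* The scale makes the rounding error [A - t B] negligible before [t B]. *)
pose t : R := 2 * n%:R ^+ 2 * K + K + 1.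
have nK_ge0 : 0 <= n%:R ^+ 2 * K by rewrite mulr_ge0 ?exprn_ge0 ?ler0n.
have t_gt0 : 0 < t by rewrite /t; lra.
pose A : 'M[int]_n := \matrix_(i, j) Num.floor (t * B i j).
pose A' : 'M[R]_n := map_mx intr A.
pose E := A' - t *: B.
have E1 i j : `|E i j| <= 1.
  have := floor_itv (t * B i j); rewrite !mxE intrD => /andP [].
  by rewrite ler_norml; lra.
have A'E : A' = t *: B + E by rewrite addrC subrK.
have detA' : `|\det A'| <= (2 * n`!%:R * t * h) ^+ n.
  pose X := V *m (t^-1 *: A').
  have -> : A' = t *: (B *m X).
    by rewrite mulmxA mulmxV // mul1mx scalerA divff ?scale1r // gt_eqF.
  have X2 i j : `|X i j| <= 2.
    have -> : X = 1%:M + t^-1 *: (V *m E).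
      rewrite /X A'E scalerDr scalerA mulVf ?gt_eqF // scale1r mulmxDr mulVmx //.
      by rewrite scalemxAr.
    rewrite !mxE; apply: le_trans (ler_normD _ _) _.
    have -> : 2 = 1 + 1 :> R by [].
    apply: lerD; first by case: eqP; rewrite ?normr1 ?normr0.
    rewrite normrM gtr0_norm ?invr_gt0 // ler_pdivrMl // mulr1.
    apply: le_trans (ler_norm_sum _ _ _) _.
    have KT : K <= t by rewrite /t; lra.
    apply: le_trans KT; apply: le_trans (VrowK i); apply: ler_sum => k _.
    by rewrite normrM ler_piMr.
  rewrite detZ det_mulmx !normrM normrX (gtr0_norm t_gt0).
  rewrite [leRHS](_ : _ = t ^+ n * (h ^+ n * (n`!%:R ^+ n * 2 ^+ n))); last first.
    by rewrite -!exprMn; congr (_ ^+ n); ring.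
  rewrite hn ler_pM2l ?exprn_gt0 // ler_pM2l //.
  apply: le_trans (normr_det_le X2) _; rewrite ler_pM2r ?exprn_gt0 //.
  by apply: ler_eXnr => //; rewrite ler1n fact_gt0.
have [s les lts] : exists2 s, (s ^ n <= `|\det A|)%N & (`|\det A| < s.+1 ^ n)%N.
  have ex0 : exists s, (s ^ n <= `|\det A|)%N by exists 0%N; rewrite exp0n.
  have bnd s : (s ^ n <= `|\det A|)%N -> (s <= `|\det A|)%N.
    apply: leq_trans; case: s => // s; rewrite -{1}[s.+1]expn1.
    exact: leq_pexp2l.
  case: (ex_maxnP ex0 bnd) => s les maxs; exists s => //.
  by rewrite ltnNge; apply/negP => /maxs; rewrite ltnn.
have s_le : s%:R <= 2 * n`!%:R * t * h :> R.
  have rhs_ge0 : 0 <= 2 * n`!%:R * t * h by rewrite !mulr_ge0 ?ler0n // ltW.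
  rewrite -(@ler_pXn2r _ n) ?nnegrE ?ler0n //.
  apply: le_trans detA'; rewrite det_map_mx -natrX -intr_norm /=.
  by rewrite -(ler_nat R) in les; apply: le_trans les _; rewrite -abszE pmulrn.
have [z z0 zs] := int_minkowski lts.
pose z' : 'rV[R]_n := map_mx intr z; pose w := z' *m B.
exists w; split; first by exists z.
  apply: contraNneq z0 => w0; have : z' = 0 by rewrite -[z'](mulmxK uB) -/w w0 mul0mx.
  move=> /rowP z'0; apply/eqP/rowP => i; have := z'0 i.
  by rewrite !mxE => /eqP; rewrite intr_eq0 => /eqP.
pose W := \sum_j `|w 0 j|.
have W_ge0 : 0 <= W by apply: sumr_ge0.
have wW j : `|w 0 j| <= W.
  by rewrite /W (bigD1 j) //= lerDl; apply: sumr_ge0.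
have z'W j : `|z' 0 j| <= K * W.
  rewrite -[z'](mulmxK uB) -/w mxE; apply: le_trans (ler_norm_sum _ _ _) _.
  rewrite /W mulr_sumr; apply: ler_sum => k _; rewrite normrM mulrC.
  by rewrite ler_wpM2r.
have tw k : t * `|w 0 k| <= s%:R + n%:R * (K * W).
  rewrite -{1}(gtr0_norm t_gt0) -normrM.
  have -> : t * w 0 k = ((z *m A) 0 k)%:~R - (z' *m E) 0 k.
    have -> : ((z *m A) 0 k)%:~R = (z' *m A') 0 k by rewrite -map_mxM [RHS]mxE.
    rewrite A'E mulmxDr [X in _ = X - _]mxE addrK -scalemxAr [RHS]mxE //.
  apply: le_trans (ler_normB _ _) _; apply: lerD.
    by rewrite -intr_norm pmulrn ler_int zs.
  rewrite mxE; apply: le_trans (ler_norm_sum _ _ _) _.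
  rewrite mulr_natl -[n in _ *+ n]card_ord -sumr_const; apply: ler_sum => j _.
  by rewrite normrM; apply: le_trans (z'W j); rewrite ler_piMr.
have tW : t * W <= n%:R * s%:R + n%:R ^+ 2 * K * W.
  rewrite /W mulr_sumr -/W; apply: (@le_trans _ _ (\sum_(k < n) (s%:R + n%:R * (K * W)))).
    by apply: ler_sum => k _; apply: tw.
  by rewrite sumr_const card_ord -mulr_natl; lra.
have WC : W <= C * h.
  rewrite -(ler_pM2l t_gt0).
  have : n%:R * s%:R <= n%:R * (2 * n`!%:R * t * h) :> R by rewrite ler_wpM2l ?ler0n.
  have : 0 <= (K + 1) * W by rewrite mulr_ge0 // addr_ge0.
  have : t * W = 2 * (n%:R ^+ 2 * K * W) + (K + 1) * W by rewrite /t; ring.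
  by rewrite /C !natrM; lra.
apply: (@le_trans _ _ (W ^+ 2)).
  rewrite expr2 {1}/W mulr_suml; apply: ler_sum => j _.
  by rewrite -real_normK ?num_real // expr2 ler_wpM2l.
have -> : `|\det B| `^ (2 / n%:R) = h ^+ 2.
  by rewrite -powR_mulrn // -powRrM mulrC.
by rewrite -exprMn ler_pXn2r ?nnegrE ?mulr_ge0.
Qed.

(** * Embeddings, traces and discriminants *)

Section Embeddings.
Variables (F : fieldExtType rat) (C : numClosedFieldType).
Implicit Types (tau : {rmorphism F -> C}) (p q : {poly rat}).
Implicit Types b : (\dim {:F}).-tuple F.

Local Notation N := (\dim {:F}).
Local Notation inF := (map_poly (in_alg F)).
Local Notation inC := (map_poly (@ratr C)).

Lemma rmorph_scale tau (a : rat) x : tau (a *: x) = ratr a * tau x.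
Proof. by rewrite -mulr_algl rmorphM alg_num_field fmorph_rat. Qed.

Lemma rmorph_horner tau p x : tau (inF p).[x] = (inC p).[tau x].
Proof.
rewrite -horner_map -map_poly_comp; congr horner.
by apply: eq_map_poly => a /=; rewrite alg_num_field fmorph_rat.
Qed.

(** Together with the minimal polynomial [q] of a primitive element, this packages
the isomorphism of [F] with [Q[X] / q] in terms of rational polynomials. *)
Lemma exists_primitive_element : exists (theta : F) (q : {poly rat}),
  [/\ size q = N.+1, separable_poly q,
      forall y, exists p, y = (inF p).[theta] &
      forall p, (inF p).[theta] = 0 <-> q %| p].
Proof.
have sepF : separable 1 {:F}.
  have pcharF : [pchar F] =i pred0 := ftrans (pchar_lalg F) (pchar_num _).
  by apply/separableP => u _; apply: pcharf0_separable.
have genF := eq_adjoin_separable_generator sepF (sub1v _).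
set theta := separable_generator _ _ in genF.
have /polyOver1P [q qE] := minPolyOver 1 theta.
exists theta, q; split.
- have := size_minPoly 1 theta; rewrite qE size_map_poly => ->.
  by rewrite adjoin_degreeE -genF dimv1 divn1.
- rewrite -(separable_map (in_alg F)) -qE; apply: separable_generatorP.
- by move=> y; apply/Fadjoin1_polyP; rewrite -genF memvf.
- move=> p; split=> [/eqP p0|/dvdpP [r ->]].
    by rewrite -(dvdp_map (in_alg F)) -qE minPoly_dvdp //; exact: alg_polyOver.
  by rewrite rmorphM hornerM /= -qE minPolyxx mulr0.
Qed.

Lemma exists_embedding theta q (c : C) :
  (forall y, exists p, y = (inF p).[theta]) ->
  (forall p, (inF p).[theta] = 0 <-> q %| p) ->
  root (inC q) c -> exists tau, tau theta = c.
Proof.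
move=> gen ker qc0.
have /choice [P PE] := gen.
have wd p p' : (inF p).[theta] = (inF p').[theta] -> (inC p).[c] = (inC p').[c].
  move=> /eqP; rewrite -subr_eq0 -hornerN -hornerD -rmorphB /= => /eqP /ker.
  move=> /dvdpP [r rE]; apply/eqP; rewrite -subr_eq0 -hornerN -hornerD.
  by rewrite -rmorphB /= rE rmorphM hornerM /= (rootP qc0) mulr0.
pose f y := (inC (P y)).[c].
have fE p : f (inF p).[theta] = (inC p).[c] by apply: wd; rewrite -PE.
have fB : zmod_morphism f.
  move=> x y; rewrite {1}(PE x) {1}(PE y) -hornerN -hornerD -rmorphB /= fE.
  by rewrite rmorphB hornerD hornerN.
have fM : monoid_morphism f.
  split; first by rewrite -(hornerC 1 theta) polyC1 -(rmorph1 inF) fE rmorph1 hornerC.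
  move=> x y; rewrite {1}(PE x) {1}(PE y) -hornerM -rmorphM /= fE.
  by rewrite rmorphM hornerM.
pose fA := GRing.isZmodMorphism.Build F C f fB.
pose fR := GRing.isMonoidMorphism.Build F C f fM.
exists (HB.pack f fA fR : {rmorphism F -> C}) => /=.
by rewrite -{1}[theta]hornerX -(map_polyX (in_alg F)) fE map_polyX hornerX.
Qed.

(** The embeddings correspond to the roots of the minimal polynomial of a
primitive element. *)
Lemma card_embeddings (T : finType) (tau : T -> {rmorphism F -> C}) :
  (forall k l, tau k =1 tau l -> k = l) ->
  (forall sigma : {rmorphism F -> C}, exists k, sigma =1 tau k) -> #|T| = N.
Proof.
move=> inj_tau all_tau.
have [theta [q [szq sepq gen ker]]] := exists_primitive_element.
have q0 : inC q != 0 by rewrite map_poly_eq0 -size_poly_gt0 szq.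
have [rs rsE] := closed_field_poly_normal (inC q).
have lq0 : lead_coef (inC q) != 0 by rewrite lead_coef_eq0.
have rootE c : root (inC q) c = (c \in rs).
  by rewrite rsE rootZ // root_prod_XsubC.
have uniq_rs : uniq rs.
  rewrite -separable_prod_XsubC -(eqp_separable (eqp_scale _ lq0)) -rsE.
  by rewrite separable_map.
have szrs : size rs = N.
  have := szq; rewrite -(size_map_poly (@ratr C)) rsE size_scale //.
  by rewrite size_prod_XsubC => -[].
have uniq_s : uniq [seq tau k theta | k : T].
  rewrite map_inj_uniq ?enum_uniq // => k l eq_kl; apply: inj_tau => y.
  by have [p ->] := gen y; rewrite !rmorph_horner eq_kl.
rewrite -szrs cardE -(size_map (fun k => tau k theta)).
apply/eqP; rewrite eqn_leq; apply/andP; split; apply: uniq_leq_size => // c.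
- move=> /mapP [k _ ->]; rewrite -rootE rootE -rootE /root -rmorph_horner.
  by rewrite (ker q).2 ?dvdpp // rmorph0.
- rewrite -rootE => /(exists_embedding gen ker) [sigma <-].
  by have [k ->] := all_tau sigma; apply: map_f; rewrite mem_enum.
Qed.

(** Indexing distinct embeddings by the degree makes the matrix of conjugates of a
basis square. *)
Variable tau : 'I_N -> {rmorphism F -> C}.
Hypothesis inj_tau : forall k l, tau k =1 tau l -> k = l.

Definition embedding_mx (b : N.-tuple F) : 'M[C]_N := \matrix_(k, j) tau k b`_j.

Lemma embedding_mx_coord (b b' : N.-tuple F) (A : 'M[rat]_N) :
  (forall j : 'I_N, b'`_j = \sum_i A i j *: b`_i) ->
  embedding_mx b' = embedding_mx b *m map_mx ratr A.
Proof.
move=> b'E; apply/matrixP => k j; rewrite !mxE b'E rmorph_sum.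
by apply: eq_bigr => i _; rewrite !mxE /= rmorph_scale mulrC.
Qed.

(** Distinct embeddings take distinct values at a primitive element, so the
matrix of its powers is a Vandermonde matrix. *)
Lemma embedding_mx_unit b : basis_of {:F} b -> embedding_mx b \in unitmx.
Proof.
move=> bF; have [theta [q [_ _ gen _]]] := exists_primitive_element.
pose pow : N.-tuple F := [tuple theta ^+ j | j < N].
have powE (j : 'I_N) : pow`_j = theta ^+ j by rewrite -tnth_nth tnth_mktuple.
have powW : embedding_mx pow = (Vandermonde N (\row_k tau k theta))^T.
  by apply/matrixP => k j; rewrite !mxE powE rmorphXn.
have : embedding_mx pow \in unitmx.
  rewrite powW unitmx_tr unitmxE det_Vandermonde unitfE.
  apply/prodf_neq0 => k _; apply/prodf_neq0 => l lt_kl; rewrite !mxE subr_eq0.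
  apply/eqP => eq_kl; move: lt_kl; rewrite (inj_tau (k := k) (l := l)) ?ltnn //.
  by move=> y; have [p ->] := gen y; rewrite !rmorph_horner eq_kl.
rewrite (@embedding_mx_coord b pow (\matrix_(i, j) coord b i pow`_j)) => [|j].
  by rewrite unitmx_mul => /andP [].
rewrite {1}(coord_basis bF (memvf pow`_j)).
by apply: eq_bigr => i _; rewrite mxE.
Qed.

(** In a rational basis, multiplication by [x] is conjugate over [C] to the
diagonal matrix of the conjugates of [x]. *)
Lemma ratr_field_trace x : ratr (field_trace x) = \sum_k tau k x.
Proof.
pose vb := vbasis {:F}.
pose A : 'M[rat]_N := \matrix_(i, j) coord vb i (x * vb`_j).
pose W := embedding_mx vb.
have uW : W \in unitmx by apply/embedding_mx_unit/vbasisP.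
have WA : diag_mx (\row_k tau k x) *m W = W *m map_mx ratr A.
  pose xvb : N.-tuple F := [tuple x * vb`_j | j < N].
  have xvbE (j : 'I_N) : xvb`_j = x * vb`_j by rewrite -tnth_nth tnth_mktuple.
  rewrite -(@embedding_mx_coord vb xvb) => [|j].
    by apply/matrixP => k j; rewrite mul_diag_mx !mxE xvbE rmorphM.
  rewrite xvbE {1}(coord_basis (vbasisP _) (memvf (x * _))).
  by apply: eq_bigr => i _; rewrite mxE.
have -> : field_trace x = \tr A by apply: eq_bigr => i _; rewrite mxE.
rewrite -trace_map_mx -[map_mx _ _](mulKmx uW) -WA mulmxA mxtrace_mulC.
by rewrite mulKVmx // mxtrace_diag; apply: eq_bigr => k _; rewrite mxE.
Qed.

Lemma ratr_basis_discriminant b :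
  ratr (basis_discriminant b) = \det (embedding_mx b) ^+ 2.
Proof.
rewrite expr2 -[X in X * _]det_tr -det_mulmx -det_map_mx; congr (\det _).
apply/matrixP => i j; rewrite !mxE /= ratr_field_trace.
by apply: eq_bigr => k _; rewrite !mxE rmorphM.
Qed.

Lemma basis_discriminant_neq0 b : (basis_discriminant b != 0) = basis_of {:F} b.
Proof.
rewrite -(fmorph_eq0 (@ratr C)) /= ratr_basis_discriminant expf_eq0 /= -unitfE -unitmxE.
apply/idP/idP => [uW|]; last exact: embedding_mx_unit.
rewrite basisEfree subvf size_tuple leqnn !andbT; apply/freeP => c c0 i.
have : embedding_mx b *m (\col_i ratr (c i)) = 0.
  apply/matrixP => k j; rewrite !mxE.
  transitivity (tau k (\sum_i c i *: b`_i)); last first.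
    by rewrite c0 rmorph0.
  rewrite rmorph_sum.
  by apply: eq_bigr => l _; rewrite !mxE /= rmorph_scale mulrC.
move=> /(congr1 (mulmx (invmx (embedding_mx b)))); rewrite mulKmx // mulmx0.
by move/matrixP/(_ i 0); rewrite !mxE => /eqP; rewrite fmorph_eq0 => /eqP.
Qed.

Lemma basis_discriminant_coord (b b' : N.-tuple F) (A : 'M[rat]_N) :
  (forall j : 'I_N, b'`_j = \sum_i A i j *: b`_i) ->
  basis_discriminant b' = \det A ^+ 2 * basis_discriminant b.
Proof.
move=> /embedding_mx_coord b'E; apply: (fmorph_inj (@ratr C)).
rewrite rmorphM rmorphXn /= !ratr_basis_discriminant b'E det_mulmx det_map_mx.
by rewrite exprMn mulrC.
Qed.

(** The algebraic numbers serve as the field in which a rational algebraic integer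
is known to be an integer. *)
Lemma integral_rat (a : rat) :
  integralOver (intr : int -> C) (ratr a) -> exists z : int, a = z%:~R.
Proof.
move=> [p mon_p pa0].
have pa : root (map_poly intr p : {poly rat}) a.
  rewrite /root -(fmorph_eq0 (@ratr C)) -horner_map -map_poly_comp /=.
  rewrite (eq_map_poly (g := intr)) // => z; exact: rmorph_int.
have : ratr a \in Aint.
  apply: (@root_monic_Aint (map_poly intr p)).
  - rewrite /root -(rmorph0 (@ratr algC)) -(rootP pa) -horner_map -map_poly_comp /=.
    by rewrite (eq_map_poly (g := intr)) // => z; exact: rmorph_int.
  - exact: monic_map.
  - by apply/polyOverP => i; rewrite coef_map intr_int.
move=> /(Cint_rat_Aint (Crat_rat a)) /intrP [z zE]; exists z.
by apply: (fmorph_inj (@ratr algC)); rewrite /= zE ratr_int.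
Qed.

Lemma integral_embedding (x : F) : ring_of_integers x ->
  forall k, integralOver (intr : int -> C) (tau k x).
Proof.
move=> [p mon_p px0] k; exists p => //.
have -> : map_poly intr p = map_poly (tau k) (map_poly intr p).
  by rewrite -map_poly_comp; apply: eq_map_poly => z /=; rewrite rmorph_int.
by rewrite fmorph_root.
Qed.

Lemma integral_field_trace (x : F) : ring_of_integers x ->
  exists z : int, field_trace x = z%:~R.
Proof.
move=> Ox; apply: integral_rat; rewrite ratr_field_trace.
apply: (big_ind (integralOver (intr : int -> C))) => [|y z|k _].
- exact: integral0.
- exact: integral_add.
- exact: integral_embedding.
Qed.

End Embeddings.

(** * Integers and integral bases *)

Section Integers.
Variable F : fieldExtType rat.
Local Notation O := (@ring_of_integers F).

Lemma integers_sub x y : O x -> O y -> O (x - y).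
Proof. exact: integral_sub. Qed.

Lemma integers_add x y : O x -> O y -> O (x + y).
Proof. exact: integral_add. Qed.

Lemma integers_mul x y : O x -> O y -> O (x * y).
Proof. exact: integral_mul. Qed.

Lemma integers_int (z : int) : O z%:~R.
Proof. exact: integral_id. Qed.

Lemma integers1 : O 1. Proof. exact: (integers_int 1). Qed.

Lemma integers0 : O 0. Proof. exact: (integers_int 0). Qed.

Lemma integers_subgroup : subgroup O.
Proof. by split; [exact: integers0 | exact: integers_sub]. Qed.

(** The [v i] form an eigenvector of [A] for [x], so [x] is a root of the
characteristic polynomial of [A]. *)
Lemma integral_of_int_matrix m (A : 'M[int]_m) (v : 'I_m -> F) (x : F) (i0 : 'I_m) :
  v i0 != 0 -> (forall i, x * v i = \sum_j v j *~ A j i) -> O x.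
Proof.
move=> vi0 xv; exists (char_poly A); first exact: char_poly_monic.
rewrite map_char_poly -eigenvalue_root_char; apply/eigenvalueP.
exists (\row_i v i).
  apply/rowP => i; rewrite !mxE xv; apply: eq_bigr => j _.
  by rewrite !mxE /= mulrzr.
by apply/eqP => /rowP /(_ i0); rewrite !mxE; apply/eqP.
Qed.

Lemma common_denominator (T : finType) (f : T -> rat) :
  exists2 d : int, d != 0 & forall i, exists z : int, d%:~R * f i = z%:~R.
Proof.
exists (\prod_i denq (f i)); first by apply/prodf_neq0 => i _; apply: denq_neq0.
move=> i; exists ((\prod_(j | j != i) denq (f j)) * numq (f i)).
by rewrite (bigD1 i) //= !intrM numqE [f i * _]mulrC mulrA [_ * (denq _)%:~R]mulrC.
Qed.

Lemma basis_neq0 (b : (\dim {:F}).-tuple F) : basis_of {:F} b ->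
  exists i : 'I_(\dim {:F}), b`_i != 0.
Proof.
move=> bF; apply: contrapT => /forallNP b0; have /eqP := oner_neq0 F; apply.
rewrite (coord_basis bF (memvf 1)) big1 // => i _.
by have /negP/negPn/eqP -> := b0 i; rewrite scaler0.
Qed.

(** Multiplication by [x] is given in a rational basis by a rational matrix, and a
common denominator makes it an integer matrix. *)
Lemma exists_integral_multiple (x : F) : exists2 d : int, d != 0 & O (x *~ d).
Proof.
pose vb := vbasis {:F}.
have xE (j : 'I_(\dim {:F})) :
    x * vb`_j = \sum_i coord vb i (x * vb`_j) *: vb`_i.
  exact: coord_basis (vbasisP _) (memvf _).
have [d d0 dA] := common_denominator
  (fun p : 'I_(\dim {:F}) * 'I_(\dim {:F}) => coord vb p.2 (x * vb`_p.1)).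
have /choice [A AE] := dA.
exists d => //.
have [i0 vi0] := basis_neq0 (vbasisP {:F}).
apply: (@integral_of_int_matrix _ (\matrix_(j, i) A (i, j)) (fun i => vb`_i) _ i0) => //.
move=> i; rewrite mulrzAl xE mulrz_suml; apply: eq_bigr => j _.
by rewrite mxE -[LHS](@scaler_int rat) -[RHS](@scaler_int rat) scalerA (AE (i, j)).
Qed.

End Integers.

Section IntegralBases.
Variables (F : fieldExtType rat) (C : numClosedFieldType).
Local Notation N := (\dim {:F}).
Local Notation O := (@ring_of_integers F).
Variable tau : 'I_N -> {rmorphism F -> C}.
Hypothesis inj_tau : forall k l, tau k =1 tau l -> k = l.
Implicit Types b : N.-tuple F.

Definition zspan b : set F :=
  [set x | exists z : 'I_N -> int, x = \sum_(i < N) b`_i *~ z i].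

Lemma integral_basis_discriminant b : (forall i : 'I_N, O b`_i) ->
  exists z : int, basis_discriminant b = z%:~R.
Proof.
move=> Ob.
have /choice [T TE] : forall p : 'I_N * 'I_N, exists z : int,
    field_trace (b`_p.1 * b`_p.2) = z%:~R.
  by move=> p; apply: (integral_field_trace inj_tau); apply: integers_mul.
exists (\det (\matrix_(i, j) T (i, j))); rewrite -det_map_mx; congr (\det _).
by apply/matrixP => i j; rewrite !mxE (TE (i, j)).
Qed.

Lemma exists_integral_tuple :
  exists2 b : N.-tuple F, basis_of {:F} b & forall i : 'I_N, O b`_i.
Proof.
pose vb := vbasis {:F}.
have /choice [d dP] : forall i : 'I_N, exists d : int, d != 0 /\ O (vb`_i *~ d).
  by move=> i; have [d d0 Od] := exists_integral_multiple vb`_i; exists d.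
pose b : N.-tuple F := [tuple vb`_i *~ d i | i < N].
have bE (i : 'I_N) : b`_i = vb`_i *~ d i by rewrite -tnth_nth tnth_mktuple.
exists b => [|i]; last by rewrite bE; case: (dP i).
rewrite -(basis_discriminant_neq0 inj_tau).
rewrite (basis_discriminant_coord inj_tau (b := vb)
           (A := diag_mx (\row_i (d i)%:~R))) => [|j].
  rewrite mulf_neq0 ?(basis_discriminant_neq0 inj_tau) ?vbasisP //.
  rewrite expf_neq0 // det_diag; apply/prodf_neq0 => i _.
  by rewrite mxE intr_eq0; case: (dP i).
rewrite bE (bigD1 j) //= big1 ?addr0 => [|i neq_ij]; rewrite !mxE.
  by rewrite eqxx scaler_int.
by rewrite (negPf neq_ij) scale0r.
Qed.

(** By expansion along row [i], which is zero off the diagonal. *)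
Lemma det_replace_col (R : comPzRingType) n (c : 'I_n -> R) (i : 'I_n) :
  \det (\matrix_(k, j) if j == i then c k else (k == j)%:R) = c i.
Proof.
set A := (\matrix_(k, j) _); rewrite (expand_det_row A i) (bigD1 i) //= big1.
  rewrite addr0 mxE eqxx /cofactor -signr_odd addnn odd_double mul1r.
  suff -> : row' i (col' i A) = 1%:M by rewrite det1 mulr1.
  by apply/matrixP => k j; rewrite !mxE (inj_eq lift_inj) eq_sym (negPf (neq_lift _ _)).
by move=> j neq_ji; rewrite mxE (negPf neq_ji) eq_sym (negPf neq_ji) mul0r.
Qed.

(** A basis of [F] in [G] of minimal absolute discriminant spans [G]: if an element of
[G] had a coordinate that is not an integer, exchanging it, reduced to its
fractional part [f], for the corresponding basis vector would multiply the
discriminant by [f ^+ 2 < 1]. *)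
Lemma subgroup_zspan (G : set F) b0 :
  subgroup G -> G `<=` O -> basis_of {:F} b0 -> (forall i : 'I_N, G b0`_i) ->
  exists2 b : N.-tuple F, basis_of {:F} b & G = zspan b.
Proof.
move=> sG GO b0F Gb0.
pose P m := `[< exists b : N.-tuple F, [/\ basis_of {:F} b, forall i : 'I_N, G b`_i &
  exists z : int, basis_discriminant b = z%:~R /\ absz z = m] >].
have exP : exists m, P m.
  have [z zE] := integral_basis_discriminant (fun i => GO _ (Gb0 i)).
  by exists (absz z); apply/asboolP; exists b0; split=> //; exists z.
case: (ex_minnP exP) => m /asboolP [b [bF Gb [z [zE zm]]]] minm.
exists b => //; apply/seteqP; split=> [x Gx|x [t ->]]; last first.
  by apply: subgroup_sum => // i; apply: subgroupMz.
have xE := coord_basis bF (memvf x).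
suff floorE i : coord b i x = (Num.floor (coord b i x))%:~R.
  exists (fun i => Num.floor (coord b i x)); rewrite {1}xE.
  by apply: eq_bigr => i _; rewrite {1}floorE scaler_int.
apply: contrapT => /eqP; rewrite -subr_eq0.
set q := Num.floor _; set f := _ - _ => f0.
have f_lt1 : `|f| < 1.
  have := floor_itv (coord b i x); rewrite intrD -/q => /andP [].
  by rewrite ltr_norml /f; lra.
pose b' : N.-tuple F := [tuple if j == i then x - b`_i *~ q else b`_j | j < N].
have b'E (j : 'I_N) : b'`_j = if j == i then x - b`_i *~ q else b`_j.
  by rewrite -tnth_nth tnth_mktuple.
have Gb' (j : 'I_N) : G b'`_j.
  by rewrite b'E; case: eqP => // _; apply: sG.2 => //; apply: subgroupMz.
have discE : basis_discriminant b' = f ^+ 2 * basis_discriminant b.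
  pose c k := coord b k x - (if k == i then q%:~R else 0).
  have -> : f = c i by rewrite /c eqxx.
  rewrite -(det_replace_col c i); apply: (basis_discriminant_coord inj_tau) => j.
  rewrite b'E; under eq_bigr => k _ do rewrite mxE.
  case: eqP => [_|_]; last first.
    rewrite (bigD1 j) //= eqxx scale1r big1 ?addr0 // => k /negPf ->.
    by rewrite scale0r.
  under eq_bigr => k _ do rewrite scalerBl.
  rewrite sumrB -xE; congr (_ - _).
  rewrite (bigD1 i) //= eqxx scaler_int big1 ?addr0 // => k /negPf ->.
  by rewrite scale0r.
have b'F : basis_of {:F} b'.
  rewrite -(basis_discriminant_neq0 inj_tau) discE mulf_neq0 ?expf_neq0 //.
  by rewrite (basis_discriminant_neq0 inj_tau).
have [z' z'E] := integral_basis_discriminant (fun i => GO _ (Gb' i)).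
have : P (absz z') by apply/asboolP; exists b'; split=> //; exists z'.
move=> /minm; rewrite -zm leqNgt => /negP; apply.
rewrite -ltz_nat !abszE -(ltr_int rat) !intr_norm -z'E -zE discE normrM normrX.
rewrite gtr_pMl ?normr_gt0 ?(basis_discriminant_neq0 inj_tau) //.
by rewrite expr_lt1.
Qed.

Lemma zspan_mem b (i : 'I_N) : zspan b b`_i.
Proof.
exists (fun j => (j == i)%:R); rewrite (bigD1 i) //= eqxx big1 ?addr0 //.
by move=> j /negPf ->.
Qed.

Lemma exists_integral_basis : exists b, integral_basis b.
Proof.
have [b0 b0F Ob0] := exists_integral_tuple.
have [b bF OE] := subgroup_zspan (@integers_subgroup F) (@subset_refl _ _) b0F Ob0.
by exists b.
Qed.

Lemma field_discriminantE :
  exists2 b : N.-tuple F, integral_basis b & field_discriminant F = basis_discriminant b.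
Proof.
have [b bP] := exists_integral_basis; rewrite /field_discriminant.
case: xgetP => [q _ [b' b'P <-]|/(_ (basis_discriminant b)) []]; first by exists b'.
by exists b.
Qed.

(** [x] acts on the basis [b] through an integer matrix. *)
Lemma integral_of_stable b x : basis_of {:F} b ->
  (forall y, zspan b y -> zspan b (x * y)) -> O x.
Proof.
move=> bF stab; have /choice [A AE] := fun i => stab _ (zspan_mem b i).
have [i0 bi0] := basis_neq0 bF.
apply: (@integral_of_int_matrix _ _ (\matrix_(j, i) A i j) (fun i => b`_i) _ i0) => //.
by move=> i; rewrite AE; apply: eq_bigr => j _; rewrite mxE.
Qed.

End IntegralBases.

(** * The index of the inverse of a fractional ideal *)

Section Ideals.
Variables (F : fieldExtType rat) (C : numClosedFieldType).
Local Notation N := (\dim {:F}).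
Local Notation O := (@ring_of_integers F).
Variable tau : 'I_N -> {rmorphism F -> C}.
Hypothesis inj_tau : forall k l, tau k =1 tau l -> k = l.
Implicit Types (b : N.-tuple F) (I J : set F).

Definition omodule J := subgroup J /\ forall a x, O a -> J x -> J (a * x).

Lemma fractional_ideal_omodule I : fractional_ideal I -> omodule I.
Proof.
move=> [[x Ix _] addI mulI _]; split=> //; split=> [|y z Iy Iz].
  by rewrite -(mul0r x); apply: mulI => //; apply: integers0.
apply: addI => //; rewrite -mulN1r; apply: mulI => //.
exact: (integers_int _ (-1)).
Qed.

Lemma basis_of_mul b (d : F) : d != 0 -> basis_of {:F} b ->
  exists2 b' : N.-tuple F, basis_of {:F} b' & forall i : 'I_N, b'`_i = d * b`_i.
Proof.
move=> d0 bF; pose b' : N.-tuple F := [tuple d * b`_i | i < N].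
have b'E (i : 'I_N) : b'`_i = d * b`_i by rewrite -tnth_nth tnth_mktuple.
exists b' => //; rewrite basisEfree subvf size_tuple leqnn !andbT.
apply/freeP => c c0; move/basis_free/freeP: bF; apply.
apply: (mulfI d0); rewrite mulr0 -[RHS]c0 mulr_sumr.
by apply: eq_bigr => i _; rewrite b'E scalerAr.
Qed.

(** Multiplying an integral basis by a nonzero element of [J] gives a basis of
[F] in [J]. *)
Lemma omodule_zspan J d : omodule J -> J `<=` O -> J d -> d != 0 ->
  exists2 b : N.-tuple F, basis_of {:F} b & J = zspan b.
Proof.
move=> [sJ mJ] JO Jd d0; have [b0 b0F Ob0] := exists_integral_tuple inj_tau.
have [b' b'F b'E] := basis_of_mul d0 b0F.
apply: (subgroup_zspan inj_tau) (b'F) _ => // i.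
by rewrite b'E mulrC; apply: mJ.
Qed.

(** A nonzero multiple [d I] lies in [O], where [omodule_zspan] applies. *)
Lemma fractional_ideal_zspan I : fractional_ideal I -> I 1 ->
  exists2 b : N.-tuple F, basis_of {:F} b & I = zspan b.
Proof.
move=> fI I1; have [sI mI] := fractional_ideal_omodule fI.
have [_ _ _ [d [Od d0] dI]] := fI.
pose J := [set y | exists2 x, I x & y = d * x].
have mJ : omodule J.
  split; first split.
  - by exists 0; rewrite ?mulr0 //; exact: sI.1.
  - by move=> _ _ [x Ix ->] [y Iy ->]; exists (x - y); rewrite ?mulrBr //; apply: sI.2.
  - by move=> a _ Oa [x Ix ->]; exists (a * x); [exact: mI | rewrite mulrCA].
have [] := @omodule_zspan J d mJ _ _ d0; first by move=> _ [x Ix ->]; exact: dI.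
  by exists 1; rewrite ?mulr1.
move=> b bF JE; have d'0 : d^-1 != 0 by rewrite invr_eq0.
have [e eF eE] := basis_of_mul d'0 bF; exists e => //.
have sumE (z : 'I_N -> int) :
    \sum_(i < N) e`_i *~ z i = d^-1 * \sum_(i < N) b`_i *~ z i.
  by rewrite mulr_sumr; apply: eq_bigr => i _; rewrite eE mulrzAr.
apply/seteqP; split=> x.
  move=> Ix; have : J (d * x) by exists x.
  by rewrite JE => -[z zE]; exists z; rewrite sumE -zE mulKf.
move=> [z ->]; rewrite sumE.
have : J (\sum_(i < N) b`_i *~ z i) by rewrite JE; exists z.
by move=> [y Iy ->]; rewrite mulKf.
Qed.

Lemma integral_of_ideal_stable J d x : omodule J -> J `<=` O -> J d -> d != 0 ->
  (forall y, J y -> J (x * y)) -> O x.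
Proof.
move=> mJ JO Jd d0 stab; have [b bF JE] := omodule_zspan mJ JO Jd d0.
by apply: (integral_of_stable bF); rewrite -JE.
Qed.

Lemma ideal_inv_subgroup J : subgroup (ideal_inv J).
Proof.
split=> [y _|x y Jx Jy z Jz]; first by rewrite mul0r; apply: integers0.
by rewrite mulrBl; apply: integers_sub; [apply: Jx | apply: Jy].
Qed.

Definition cyclic_omodule (x : F) : set F := [set y | exists2 a, O a & y = a * x].

Lemma cyclic_omodule_sub J x : omodule J -> J x -> cyclic_omodule x `<=` J.
Proof. by move=> [_ mJ] Jx _ [a Oa ->]; apply: mJ. Qed.

(** An element [x] of [I \ J] for which [(J + O x) / J] is as small as possible
generates a simple quotient: any [a x] outside [J] generates it as well. *)
Lemma exists_simple_generator I J (T : finType) (r : T -> F) :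
  omodule I -> omodule J -> covering I J r -> ~ (I `<=` J) ->
  exists x (q : nat) (s : 'I_q -> F),
    [/\ I x, ~ J x, packing (cyclic_omodule x) J s, covering (cyclic_omodule x) J s &
        forall a, O a -> ~ J (a * x) -> exists2 t, O t & J ((1 - t * a) * x)].
Proof.
move=> mI [sJ mJ] covI /existsNP [x0 /not_implyP [Ix0 nJx0]].
have cov_cyc x : I x -> exists (q : nat) (s : 'I_q -> F),
    packing (cyclic_omodule x) J s /\ covering (cyclic_omodule x) J s.
  move=> Ix; apply: (exists_packing_covering (r := r)) => // y.
  by move=> /(cyclic_omodule_sub mI Ix); apply: covI.
pose P q := `[< exists x (s : 'I_q -> F), [/\ I x, ~ J x,
  packing (cyclic_omodule x) J s & covering (cyclic_omodule x) J s] >].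
have exP : exists q, P q.
  have [q [s [ps cs]]] := cov_cyc _ Ix0.
  by exists q; apply/asboolP; exists x0, s.
case: (ex_minnP exP) => q /asboolP [x [s [Ix nJx ps cs]]] minq.
exists x, q, s; split=> // a Oa nJax.
have Iax : I (a * x) by apply: mI.2.
have [q' [s' [ps' cs']]] := cov_cyc _ Iax.
have le_qq' : (q <= q')%N by apply: minq; apply/asboolP; exists (a * x), s'.
have psx : packing (cyclic_omodule x) J s'.
  split; last exact: ps'.2.
  move=> i; have [t Ot ->] := ps'.1 i.
  by exists (t * a); [apply: integers_mul | rewrite mulrA].
have [||i] := packing_covering sJ psx cs _ (x := x).
- by rewrite !card_ord.
- by exists 1; [exact: integers1 | rewrite mul1r].
have [t Ot ->] := ps'.1 i => Jd; exists t => //.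
by rewrite mulrBl mul1r -mulrA.
Qed.

(** With [p] the annihilator of [x] in [(J + O x) / J], a maximal ideal,
multiplication by [x] embeds [J^-1 / (J + O x)^-1] into [p^-1 / O], and this has
at most as many elements as [O / p], which is isomorphic to [(J + O x) / J].
Indeed [p^-1 / O] is trivial if [p^-1 p] is contained in [p], because [p^-1] is
then integral; otherwise some [a y] with [a] in [p] and [y] in [p^-1] is a unit
modulo [p], and [y] generates [p^-1] modulo [O]. *)
Lemma ideal_chain_step I J (T : finType) (r : T -> F) (d : F) :
  omodule I -> omodule J -> O `<=` J -> J `<=` I -> ~ (I `<=` J) ->
  covering I J r -> d != 0 -> O d -> (forall x, I x -> O (d * x)) ->
  exists (J' : set F) (q : nat) (s s' : 'I_q -> F),
    [/\ [/\ omodule J', J `<=` J' & J' `<=` I], (1 < q)%N, packing J' J s &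
        covering (ideal_inv J) (ideal_inv J') s'].
Proof.
move=> mI mJ OJ JI nIJ covI d0 Od dI; have [sJ mulJ] := mJ.
have [x [q [s [Ix nJx ps cs simple]]]] := exists_simple_generator mI mJ covI nIJ.
have /choice [a aP] : forall i, exists a, O a /\ s i = a * x.
  by move=> i; have [a Oa ->] := ps.1 i; exists a.
pose p : set F := [set c | O c /\ J (c * x)].
have mp : omodule p.
  split; first split.
  - by split; [exact: integers0 | rewrite mul0r; exact: sJ.1].
  - move=> c c' [Oc Jc] [Oc' Jc']; split; first exact: integers_sub.
    by rewrite mulrBl; apply: sJ.2.
  - move=> c c' Oc [Oc' Jc']; split; first exact: integers_mul.
    by rewrite -mulrA; apply: mulJ.
have pO : p `<=` O by move=> c [].
have pd : p d by split=> //; apply/OJ/dI.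
(* [y] generates [p^-1] modulo [O]; it is [0] if [p^-1] is contained in [O]. *)
have [y yP] : exists y, forall w, ideal_inv p w -> exists i, O (w - a i * y).
  case: (pselect (exists y c, [/\ ideal_inv p y, p c & ~ p (y * c)])).
    move=> [y [c [py pc npyc]]]; exists y => w pw.
    have Oyc : O (y * c) by apply: py.
    have [t Ot Jt] : exists2 t, O t & J ((1 - t * (y * c)) * x).
      by apply: simple => // Jyc; apply: npyc.
    have p1 : p (1 - t * (y * c)).
      split=> //; apply: integers_sub; first exact: integers1.
      exact: integers_mul.
    have Otwc : O (t * (w * c)) by apply: integers_mul => //; apply: pw.
    have [i Ji] : exists i, J (t * (w * c) * x - s i).
      by apply: cs; exists (t * (w * c)).
    have [Oai siE] := aP i; exists i.
    have pi : p (t * (w * c) - a i).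
      by split; [exact: integers_sub | rewrite mulrBl -siE].
    have -> : w - a i * y = w * (1 - t * (y * c)) + y * (t * (w * c) - a i) by ring.
    by apply: integers_add; [apply: pw | apply: py].
  move=> nyc; exists 0 => w pw; have [i _] : exists i, J (0 * x - s i).
    by apply: cs; exists 0 => //; exact: integers0.
  exists i; rewrite mulr0 subr0; apply: (integral_of_ideal_stable mp pO pd d0).
  by move=> c pc; apply: contrapT => npwc; apply: nyc; exists w, c.
pose J' : set F := [set z | exists2 c, O c & J (z - c * x)].
have JJ' : J `<=` J'.
  by move=> z Jz; exists 0; [exact: integers0 | rewrite mul0r subr0].
have J'a c : O c -> J' (c * x) by exists c => //; rewrite subrr; exact: sJ.1.
have mJ' : omodule J'.
  split; first split; first exact/JJ'/sJ.1.
  - move=> z z' [c Oc Jc] [c' Oc' Jc']; exists (c - c'); first exact: integers_sub.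
    have -> : z - z' - (c - c') * x = (z - c * x) - (z' - c' * x) by ring.
    exact: sJ.2.
  - move=> e z Oe [c Oc Jc]; exists (e * c); first exact: integers_mul.
    by rewrite -mulrA -mulrBr; apply: mulJ.
have J'I : J' `<=` I.
  move=> z [c Oc /JI Iz]; rewrite -(subrK (c * x) z).
  by apply: subgroupD => //; [exact: mI.1 | apply: mI.2].
have q_gt1 : (1 < q)%N.
  have p2 : packing (cyclic_omodule x) J (fun e : bool => e%:R * x).
    split=> [[]|[] []] //=; rewrite ?mul1r ?mul0r ?subr0 ?sub0r //.
    - by exists 1; [exact: integers1 | rewrite mul1r].
    - by exists 0; [exact: integers0 | rewrite mul0r].
    - by move=> /(subgroupN sJ); rewrite opprK.
  by have := packing_le_covering sJ p2 cs; rewrite card_bool card_ord.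
have [s' s'P] : exists s' : 'I_q -> F, covering (ideal_inv J) (ideal_inv J') s'.
  have covp : covering (ideal_inv p) O (fun i => a i * y) by [].
  apply: (covering_preim (integers_subgroup F) (mulrBr x) _ _ covp).
    move=> w Jw c [Oc Jcx]; have -> : x * w * c = w * (c * x) by ring.
    exact: Jw.
  move=> w w' Jw Jw' Oxw z [c Oc Jz].
  have -> : (w - w') * z = (w - w') * (z - c * x) + c * (x * (w - w')) by ring.
  apply: integers_add; last exact: integers_mul.
  by rewrite mulrBl; apply: integers_sub; [apply: Jw | apply: Jw'].
exists J', q, s, s'; split=> //; split; last exact: ps.2.
by move=> i; have [Oa ->] := aP i; apply: J'a.
Qed.

(** Among the modules [J] between [O] and [I] for which the index of [J^-1] in [O]
is at most that of [O] in [J], one with the largest index must be [I], since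
otherwise [ideal_chain_step] would enlarge it. *)
Lemma ideal_inv_covering I (T : finType) (r : T -> F) :
  fractional_ideal I -> I 1 -> covering I O r ->
  exists (T' : finType) (s : T' -> F), (#|T'| <= #|T|)%N /\ covering O (ideal_inv I) s.
Proof.
move=> fI I1 covI; have mI := fractional_ideal_omodule fI.
have [_ _ _ [d [Od d0] dI]] := fI.
have sO := integers_subgroup F.
pose P k := `[< exists (J : set F) (T' : finType) (s s' : T' -> F),
  [/\ [/\ omodule J, O `<=` J & J `<=` I], packing J O s,
      covering O (ideal_inv J) s' & #|T'| = k] >].
have P1 : P 1%N.
  apply/asboolP; exists O, unit, (fun=> 0), (fun=> 0).
  have mO : omodule O by split=> //; exact: integers_mul.
  split; rewrite ?card_unit //.
  - by split=> // x Ox; rewrite -(mulr1 x); apply: mI.2.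
  - by split=> [_|[] []]; first exact: integers0.
  - by move=> x Ox; exists tt => y Oy; rewrite subr0; apply: integers_mul.
have bound k : P k -> (k <= #|T|)%N.
  move=> /asboolP [J [T' [s [_ [[_ _ JI] [Js injs] _ <-]]]]].
  by apply: (packing_le_covering (r := s) sO _ covI); split=> // i; apply: JI.
case: (ex_maxnP (ex_intro (fun k => is_true (P k)) _ P1) bound) => k Pk maxk.
have k_gt0 : (0 < k)%N by apply: maxk.
have le_kT := bound _ Pk.
move: Pk => /asboolP [J [T' [s [s' [[mJ OJ JI] ps cs' cardT']]]]].
case: (pselect (I `<=` J)) => [IJ|nIJ].
  by exists T', s'; rewrite cardT' (_ : I = J) //; apply/seteqP.
have covIJ : covering I J r by move=> x /covI [i /OJ]; exists i.
have [J' [q [u [u' [[mJ' JJ' J'I] q_gt1 pu cu']]]]] :=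
  ideal_chain_step mI mJ OJ JI nIJ covIJ d0 Od dI.
suff /maxk : P (k * q)%N by rewrite leqNgt ltn_Pmulr.
apply/asboolP; exists J', ('I_q * T')%type, (fun i => u i.1 + s i.2).
exists (fun i => s' i.2 + u' i.1); split.
- by split=> // x /OJ /JJ'.
- exact: packing_mul mJ'.1 mJ.1 JJ' OJ pu ps.
- move=> x /(covering_mul cs' cu') [[i j] Ji].
  by exists (j, i).
- by rewrite card_prod card_ord cardT' mulnC.
Qed.

(** Coordinates reduce the index to that of a lattice in [Z ^ n]. *)
Lemma zspan_covering b b' (M : 'M[int]_N) : \det M != 0 ->
  (forall j : 'I_N, b'`_j = \sum_(i < N) b`_i *~ M i j) ->
  exists (T : finType) (r : T -> F), #|T| = absz (\det M) /\
    covering (zspan b) (zspan b') r.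
Proof.
rewrite -det_tr => detM b'E.
have [T [r [cardT cov]]] := row_lattice_covering detM.
exists T, (fun t => \sum_(i < N) b`_i *~ r t 0 i); split=> // _ [z ->].
have [t [y yE]] := cov (\row_i z i) I; exists t, (fun k => y 0 k).
rewrite -sumrB; transitivity (\sum_(i < N) b`_i *~ (y *m M^T) 0 i).
  by apply: eq_bigr => i _; rewrite -yE !mxE mulrzBr.
under [RHS]eq_bigr => k _ do rewrite b'E mulrz_suml.
rewrite exchange_big /=; apply: eq_bigr => i _.
rewrite mxE mulrz_sumr; apply: eq_bigr => k _.
by rewrite mxE mulrC mulrzA.
Qed.

End Ideals.

Lemma has_index_packing (F : fieldExtType rat) (A B : set F) k :
  subgroup B -> has_index A B k -> exists r : 'I_k -> F, packing A B r.
Proof.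
move=> [B0 _] [_ [r [Ar rP]]]; exists r; split=> // i j Bij.
have [i0 [_ uniq_i0]] := rP _ (Ar i).
by rewrite -(uniq_i0 i) ?subrr // (uniq_i0 j).
Qed.

Section NormBound.
Variables (F : fieldExtType rat) (C : numClosedFieldType).
Local Notation N := (\dim {:F}).
Local Notation O := (@ring_of_integers F).
Variable tau : 'I_N -> {rmorphism F -> C}.
Hypothesis inj_tau : forall k l, tau k =1 tau l -> k = l.

(** Both factors of the index of [d I^-1] in [O], through [d O], are counted by
cosets. *)
Lemma ideal_norm_inv_le (I : set F) (T : finType) (r : T -> F) :
  fractional_ideal I -> I 1 -> covering I O r -> 0 < ideal_norm (ideal_inv I) ->
  ideal_norm (ideal_inv I) <= #|T|%:R.
Proof.
move=> fI I1 covI; rewrite /ideal_norm; case: xgetP => [q _|_]; last by rewrite ltxx.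
move=> [d [k [d_gt0 indexk ->]]] _.
have d0 : d%:Z != 0 by rewrite eqz_nat -lt0n.
pose dset (J : set F) := [set d%:R * x | x in J].
have sdI : subgroup (dset (ideal_inv I)).
  split; first by exists 0; [exact: (ideal_inv_subgroup I).1 | rewrite mulr0].
  move=> _ _ [x Ix <-] [y Iy <-]; exists (x - y); last by rewrite mulrBr.
  exact: (ideal_inv_subgroup I).2.
have [s ps] := has_index_packing sdI indexk.
have [T' [t [le_T' ct]]] := ideal_inv_covering inj_tau fI I1 covI.
have ct' : covering (dset O) (dset (ideal_inv I)) (fun i => d%:R * t i).
  move=> _ [x /ct [i Ii] <-]; exists i; exists (x - t i) => //.
  by rewrite mulrBr.
have [b [bF OE]] := exists_integral_basis inj_tau.
pose db : N.-tuple F := [tuple d%:R * b`_i | i < N].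
have dbE (i : 'I_N) : db`_i = d%:R * b`_i by rewrite -tnth_nth tnth_mktuple.
have [|j|T2 [r2 [cardT2 cov2]]] := @zspan_covering _ b db (d%:Z)%:M.
- by rewrite det_scalar expf_neq0.
- rewrite dbE (bigD1 j) //= big1 ?addr0 => [|i /negPf neq]; rewrite !mxE ?eqxx ?neq //.
  by rewrite mulr1n mulr_natl.
have cov2' : covering O (dset O) r2.
  rewrite OE => x /cov2 [i [z zE]]; exists i.
  exists (\sum_(i < N) b`_i *~ z i); first by exists z.
  by rewrite zE mulr_sumr; apply: eq_bigr => l _; rewrite dbE mulrzAr.
have := packing_le_covering sdI ps (covering_mul cov2' ct').
rewrite card_ord card_prod cardT2 det_scalar abszX absz_nat => le_k.
rewrite ler_pdivrMr ?exprn_gt0 ?ltr0n // -natrX -natrM ler_nat.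
by apply: leq_trans le_k _; rewrite mulnC leq_mul2r le_T' orbT.
Qed.

(** Here [m], the absolute value of the determinant of an integral basis in terms
of a [Z]-basis of [I], is the index of [O] in [I]. *)
Lemma ideal_norm_inv_le_discriminant (I : set F) :
  fractional_ideal I -> I 1 -> 0 < ideal_norm (ideal_inv I) ->
  exists (e : N.-tuple F) (m : nat), [/\ basis_of {:F} e, I = zspan e,
    field_discriminant F = m%:R ^+ 2 * basis_discriminant e &
    ideal_norm (ideal_inv I) <= m%:R].
Proof.
move=> fI I1 norm_gt0.
have [e eF IE] := fractional_ideal_zspan inj_tau fI I1.
have [b [bF OE] ->] := field_discriminantE inj_tau.
have /choice [M0 M0E] : forall j : 'I_N, exists z : 'I_N -> int,
    b`_j = \sum_(i < N) e`_i *~ z i.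
  move=> j; suff : I b`_j by rewrite IE.
  have Ob : O b`_j by rewrite OE; apply: zspan_mem.
  by rewrite -(mulr1 b`_j); apply: (fractional_ideal_omodule fI).2.
pose M : 'M[int]_N := \matrix_(i, j) M0 j i.
have ME (j : 'I_N) : b`_j = \sum_(i < N) e`_i *~ M i j.
  by rewrite M0E; apply: eq_bigr => i _; rewrite mxE.
have discE : basis_discriminant b = (\det M)%:~R ^+ 2 * basis_discriminant e.
  rewrite -det_map_mx; apply: (basis_discriminant_coord inj_tau) => j.
  by rewrite ME; apply: eq_bigr => i _; rewrite [map_mx _ _ _ _]mxE /= scaler_int.
have detM : \det M != 0.
  have := basis_discriminant_neq0 inj_tau b; rewrite bF discE mulf_eq0 negb_or.
  by case/andP; rewrite expf_eq0 /= intr_eq0.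
have [T [r [cardT covT]]] := zspan_covering detM ME.
exists e, (absz (\det M)); split=> //.
  have -> : (absz (\det M))%:R = `|(\det M)%:~R| :> rat.
    by rewrite -intr_norm -abszE -pmulrn.
  by rewrite discE real_normK ?num_real.
rewrite -cardT; apply: (@ideal_norm_inv_le _ _ r) => //.
by rewrite IE OE.
Qed.

End NormBound.

(** * The lattice of an ideal *)

Section Lattice.
Variables (R : realType) (F : fieldExtType rat) (r1 r2 : nat).
Variable sigma : 'I_(r1 + r2) -> {rmorphism F -> R[i]}.
Local Notation N := (\dim {:F}).

Definition conj_embedding (tau : {rmorphism F -> R[i]}) : {rmorphism F -> R[i]} :=
  GRing.RMorphism.clone F R[i] (conjc \o tau) _.

(** Both embeddings of a conjugate pair are listed, and the same type indexes the
real coordinates: the two real coordinates of a complex embedding take the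
places of the pair. *)
Local Notation index := ('I_r1 + ('I_r2 + 'I_r2))%type.

Definition embedding (k : index) : {rmorphism F -> R[i]} :=
  match k with
  | inl i => sigma (lshift r2 i)
  | inr (inl i) => sigma (rshift r1 i)
  | inr (inr i) => conj_embedding (sigma (rshift r1 i))
  end.

Definition weight (u : 'I_(r1 + r2) -> R) (k : index) : R :=
  match k with
  | inl i => u (lshift r2 i)
  | inr (inl i) => u (rshift r1 i)
  | inr (inr i) => u (rshift r1 i)
  end.

Definition coordinate (u : 'I_(r1 + r2) -> R) (k : index) (x : F) : R :=
  match k with
  | inl i => u (lshift r2 i) * complex.Re (sigma (lshift r2 i) x)
  | inr (inl i) =>
      Num.sqrt 2 * u (rshift r1 i) * complex.Re (sigma (rshift r1 i) x)
  | inr (inr i) =>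
      Num.sqrt 2 * u (rshift r1 i) * complex.Im (sigma (rshift r1 i) x)
  end.

Lemma coordinateB u k : zmod_morphism (coordinate u k).
Proof.
by move=> x y; case: k => [i|[i|i]] /=; rewrite rmorphB /=;
  case: (sigma _ x) (sigma _ y) => a b [a' b'] /=; rewrite mulrBr.
Qed.

HB.instance Definition _ u k :=
  GRing.isZmodMorphism.Build F R (coordinate u k) (coordinateB u k).

Hypothesis sigmaP : embeddings_up_to_conj sigma.

Lemma unorm_sqr u x : unorm sigma u x ^+ 2 = \sum_k coordinate u k x ^+ 2.
Proof.
rewrite sqr_sqrtr; last first.
  by rewrite addr_ge0 ?mulr_ge0 ?sumr_ge0 // => i _; rewrite mulr_ge0 ?sqr_ge0.
have normc_sqr (z : R[i]) : Normc.normc z ^+ 2 = complex.Re z ^+ 2 + complex.Im z ^+ 2.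
  by case: z => a b /=; rewrite sqr_sqrtr // addr_ge0 ?sqr_ge0.
have s2 := sqr_sqrtr (ler0n R 2).
rewrite !big_sumType /= -big_split /= mulr_sumr; congr (_ + _); apply: eq_bigr => i _.
  have [realP _ _ _] := sigmaP.
  by rewrite normc_sqr realP exprMn expr0n addr0.
by rewrite normc_sqr -[X in X * _ = _]s2; ring.
Qed.

(** The coordinates are isometric to the weighted conjugates: a conjugate pair
contributes [2 * Re (x * conj y)], whence the factor [sqrt 2]. *)
Lemma sum_coordinate_mul u x y :
  (\sum_k coordinate u k x * coordinate u k y)%:C%C =
  \sum_k (weight u k ^+ 2)%:C%C * (embedding k x * conjc (embedding k y)).
Proof.
have [realP _ _ _] := sigmaP.
rewrite rmorph_sum !big_sumType /= -!big_split /=; congr (_ + _).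
  apply: eq_bigr => i _; have := realP i x; have := realP i y.
  by case: (sigma _ x) (sigma _ y) => a b [a' b'] /= -> ->; simpc; congr Complex; ring.
apply: eq_bigr => i _; case: (sigma _ x) (sigma _ y) => a b [a' b'] /=.
have s2 (p q v : R) : Num.sqrt 2 * v * p * (Num.sqrt 2 * v * q) = 2 * v ^+ 2 * p * q.
  by rewrite -[X in _ = X * _ * _ * _](sqr_sqrtr (ler0n R 2)); ring.
by rewrite !s2; simpc; congr Complex; ring.
Qed.

Lemma embedding_inj k l : embedding k =1 embedding l -> k = l.
Proof.
have [realP cplxP uniqP _] := sigmaP.
have uniqP' i j : sigma i =1 (fun x => conjc (sigma j x)) -> i = j.
  by move=> ?; apply: uniqP; right.
have uniqP1 i j : sigma i =1 sigma j -> i = j by move=> ?; apply: uniqP; left.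
have not_self i : ~ sigma (rshift r1 i) =1 (fun x => conjc (sigma (rshift r1 i) x)).
  move=> eq_conj; have [x /negP] := cplxP i; apply.
  by have := eq_conj x; case: (sigma _ x) => a b [bE] /=; apply/eqP; lra.
case: k l => [i|[i|i]] [j|[j|j]] /= eq_kl.
- by rewrite (lshift_inj (uniqP1 _ _ eq_kl)).
- by have /eqP := uniqP1 _ _ eq_kl; rewrite eq_lrshift.
- by have /eqP := uniqP' _ _ eq_kl; rewrite eq_lrshift.
- by have /eqP := uniqP1 _ _ eq_kl; rewrite eq_rlshift.
- by rewrite (rshift_inj (uniqP1 _ _ eq_kl)).
- have eq_ij := rshift_inj (uniqP' _ _ eq_kl).
  by case: (@not_self i) => x; rewrite {1}eq_kl eq_ij.
- have /eqP : rshift r1 i = lshift r2 j by apply: uniqP' => x; rewrite -eq_kl /= conjcK.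
  by rewrite eq_rlshift.
- have eq_ij : i = j.
    by apply: (@rshift_inj r1); apply: uniqP' => x; rewrite -eq_kl /= conjcK.
  by case: (@not_self i) => x; have := eq_kl x; rewrite -eq_ij => /esym.
- congr (inr (inr _)); apply: (@rshift_inj r1); apply: uniqP1 => x.
  by have /= := eq_kl x; move/(congr1 conjc); rewrite !conjcK.
Qed.

(** The indices list the embeddings of [F] without repetition. *)
Lemma card_index : #|{: index}| = N.
Proof.
apply: (card_embeddings embedding_inj) => tau.
have [_ _ _ complete] := sigmaP; have [k] := complete tau.
rewrite -[k]fintype.splitK; case: (fintype.split k) => j /= [] tauE.
- by exists (inl j).
- exists (inl j) => x; rewrite tauE /=; have [realP _ _ _] := sigmaP.
  by have := realP j x; case: (sigma _ x) => a b /= ->; rewrite oppr0.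
- by exists (inr (inl j)).
- by exists (inr (inr j)).
Qed.

Definition index_of (k : 'I_N) : index := enum_val (cast_ord (esym card_index) k).

Lemma index_of_bij : bijective index_of.
Proof.
exists (fun k => cast_ord card_index (enum_rank k)) => k.
  by rewrite /index_of enum_valK cast_ordKV.
by rewrite /index_of cast_ordK enum_rankK.
Qed.

Lemma embedding_index_inj k l :
  embedding (index_of k) =1 embedding (index_of l) -> k = l.
Proof. by move=> /embedding_inj; apply: (bij_inj index_of_bij). Qed.

Definition lattice_mx u (e : N.-tuple F) : 'M[R]_N :=
  \matrix_(j, k) coordinate u (index_of k) e`_j.

(** Since [B B^T = W^T D conj(W)], with [W] the matrix of all conjugates of [e] and
[D] the diagonal matrix of the squared weights, the fourth power of [\det B] is
the square of [\det D * \det W ^+ 2], and [\det W ^+ 2] is the discriminant. *)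
Lemma det_lattice_mx u e :
  \det (lattice_mx u e) ^+ 2 =
  (\prod_k weight u k ^+ 2) * `|ratr (basis_discriminant e)|.
Proof.
set B := lattice_mx u e; pose W := embedding_mx (fun k => embedding (index_of k)) e.
pose w := \row_(k < N) (weight u (index_of k) ^+ 2)%:C%C.
have BB : map_mx (real_complex R) (B *m B^T) = W^T *m (diag_mx w *m map_mx conjc W).
  apply/matrixP => j l; rewrite mul_diag_mx !mxE.
  transitivity ((\sum_k coordinate u k e`_j * coordinate u k e`_l)%:C%C).
    rewrite (reindex index_of) /=; last exact/onW_bij/index_of_bij.
    by congr (_%:C%C); apply: eq_bigr => k _; rewrite !mxE.
  rewrite sum_coordinate_mul (reindex index_of) /=; last exact/onW_bij/index_of_bij.
  by apply: eq_bigr => k _; rewrite !mxE mulrCA.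
have prod_w : \prod_k w 0 k = (\prod_k weight u k ^+ 2)%:C%C.
  rewrite rmorph_prod [RHS](reindex index_of) /=; last exact/onW_bij/index_of_bij.
  by apply: eq_bigr => k _; rewrite mxE.
have [D -> discE] : exists2 D : R, ratr (basis_discriminant e) = D &
    \det W ^+ 2 = D%:C%C.
  exists (ratr (basis_discriminant e)) => //.
  rewrite -(ratr_basis_discriminant embedding_index_inj).
  by rewrite [RHS](fmorph_rat (real_complex R)).
have detB : \det B ^+ 2 ^+ 2 = ((\prod_k weight u k ^+ 2) * `|D|) ^+ 2.
  rewrite [RHS]exprMn real_normK ?num_real //; apply: complexI.
  have := congr1 (fun M => \det M ^+ 2) BB.
  rewrite det_map_mx !det_mulmx !det_tr det_diag det_map_mx -expr2 prod_w /=.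
  rewrite -rmorphXn /= => ->; rewrite !exprMn -[conjc _ ^+ 2]rmorphXn /= discE.
  by rewrite conjc_real [RHS]rmorphM !rmorphXn /= mulrCA; congr (_ * _).
apply/eqP; rewrite -(@eqrXn2 _ 2) ?detB ?sqr_ge0 //.
by rewrite mulr_ge0 // prodr_ge0 // => k _; apply: sqr_ge0.
Qed.

Lemma unorm1_sqr u : unorm sigma u 1 ^+ 2 = \sum_k weight u k ^+ 2.
Proof.
apply: complexI; rewrite unorm_sqr sum_coordinate_mul rmorph_sum.
by apply: eq_bigr => k _; rewrite rmorph1 conjc1 !mulr1.
Qed.

Lemma lattice_mxP u e x : lattice (lattice_mx u e) x ->
  exists2 g, zspan e g & forall k, x 0 k = coordinate u (index_of k) g.
Proof.
move=> [z ->]; exists (\sum_(j < N) e`_j *~ z 0 j); first by exists (z 0).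
move=> k; rewrite raddf_sum mxE; apply: eq_bigr => j _.
by rewrite raddfMz !mxE mulrzl.
Qed.

(** Every Hermite bound is at least [||1||_u ^ 2 / covol ^ (2 / n)] when [1] is a
shortest vector of [I]; hence so is their infimum. *)
Lemma hermite_constant_ge u (I : set F) (e : N.-tuple F) :
  basis_of {:F} e -> I = zspan e -> (forall i, 0 < u i) ->
  (forall g, I g -> g != 0 -> unorm sigma u 1 <= unorm sigma u g) ->
  unorm sigma u 1 ^+ 2 <=
    hermite_constant R N * `|\det (lattice_mx u e)| `^ (2 / N%:R).
Proof.
move=> eF IE u_gt0 min1; set B := lattice_mx u e; set h := _ `^ _.
have detB0 : \det B != 0.
  rewrite -sqrf_eq0 det_lattice_mx mulf_neq0 //.
    apply/prodf_neq0 => k _; rewrite expf_neq0 ?gt_eqF //.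
    by case: k => [j|[j|j]]; apply: u_gt0.
  by rewrite normr_eq0 fmorph_eq0 (basis_discriminant_neq0 embedding_index_inj).
have h_gt0 : 0 < h by apply: powR_gt0; rewrite normr_gt0.
rewrite -ler_pdivrMr //; apply: lb_le_inf.
  by apply: hermite_bound_nonempty; apply: adim_gt0.
move=> c /(_ B); rewrite unitmxE unitfE => /(_ detB0) [x [Lx x0]].
rewrite -/h ler_pdivrMr //; apply: le_trans.
have [g eg xg] := lattice_mxP Lx.
have -> : \sum_j x 0 j ^+ 2 = unorm sigma u g ^+ 2.
  rewrite unorm_sqr [RHS](reindex index_of) /=; last exact/onW_bij/index_of_bij.
  by apply: eq_bigr => k _; rewrite xg.
rewrite ler_pXn2r ?nnegrE ?sqrtr_ge0 //; apply: min1; first by rewrite IE.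
apply: contraNneq x0 => g0; apply/eqP/rowP => k.
by rewrite xg g0 raddf0 mxE.
Qed.

End Lattice.

(** * The bound on the norm *)

(** The numerical core: raising the Hermite inequality to the power [n] makes
[delta ^ 2 = P * D] appear, and [P] cancels against the lower bound for [S ^ n]
given by the means. In the application [S = ||1||_u ^ 2], [P] is the product of
the squared weights, and [delta] and [D] come from the lattice and the
discriminant of a basis of [I]. *)
Lemma index_bound (R : realType) (n m : nat) (gamma delta S P D : R) :
  (0 < n)%N -> 0 < P -> 0 < D -> 0 < S -> P <= (S / n%:R) ^+ n ->
  delta ^+ 2 = P * D -> S <= gamma * `|delta| `^ (2 / n%:R) ->
  m%:R <= Num.sqrt (m%:R ^+ 2 * D / (n%:R / gamma) ^+ n).
Proof.
move=> n_gt0 P_gt0 D_gt0 S_gt0 agm deltaE hermite; set h := _ `^ _ in hermite.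
have n0 : 0 < n%:R :> R by rewrite ltr0n.
have hn : h ^+ n = P * D.
  rewrite -powR_mulrn ?powR_ge0 // -powRrM -mulrA mulVf ?gt_eqF // mulr1.
  by rewrite powR_mulrn // real_normK ?num_real.
have h_ge0 : 0 <= h by apply: powR_ge0.
have gamma_gt0 : 0 < gamma.
  rewrite ltNge; apply: contraL S_gt0 => gamma_le0; rewrite -leNgt.
  by apply: le_trans hermite _; rewrite mulr_le0_ge0.
have c_gt0 : 0 < (n%:R / gamma) ^+ n by rewrite exprn_gt0 // divr_gt0.
have cD : (n%:R / gamma) ^+ n <= D.
  rewrite expr_div_n ler_pdivrMr ?exprn_gt0 // -(ler_pM2l P_gt0).
  rewrite expr_div_n ler_pdivlMr ?exprn_gt0 // in agm; apply: le_trans agm _.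
  have : S ^+ n <= (gamma * h) ^+ n by apply: lerXn2r; rewrite // nnegrE ?mulr_ge0 // ltW.
  by rewrite exprMn hn (_ : gamma ^+ n * (P * D) = P * (D * gamma ^+ n)) //; ring.
rewrite -[leLHS]ger0_norm // -sqrtr_sqr ler_wsqrtr // ler_pdivlMr //.
by rewrite ler_wpM2l ?sqr_ge0.
Qed.

Theorem proposition3p1 (R : realType) (F : fieldExtType rat) (n r1 r2 : nat)
    (sigma : 'I_(r1 + r2) -> {rmorphism F -> R[i]}) (I : set F)
    (dimF : \dim {:F} = n)
    (sigmaP : embeddings_up_to_conj sigma)
    (fracI : fractional_ideal I) (I1 : I 1) :
  let c := (n%:R / hermite_constant R n) ^+ n in
  Num.sqrt (`|ratr (field_discriminant F)| / c) < ratr (ideal_norm (ideal_inv I)) ->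
  ~ one_reduced sigma I.
Proof.
subst n => c lt_norm [_ [u u_gt0 min1]].
have inj_emb := @embedding_index_inj _ _ _ _ _ sigmaP.
have norm_gt0 : 0 < ideal_norm (ideal_inv I).
  by rewrite -(ltr0q R); apply: le_lt_trans lt_norm; apply: sqrtr_ge0.
have [e [m [eF IE discE norm_le]]] :=
  ideal_norm_inv_le_discriminant inj_emb fracI I1 norm_gt0.
have w_gt0 k : 0 < weight u k ^+ 2.
  by rewrite exprn_gt0 //; case: k => [j|[j|j]]; apply: u_gt0.
have n_gt0 : (0 < \dim {:F})%N by apply: adim_gt0.
have disc_gt0 : 0 < `|ratr (basis_discriminant e) : R|.
  by rewrite normr_gt0 fmorph_eq0 (basis_discriminant_neq0 inj_emb).
have agm : \prod_k weight u k ^+ 2 <=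
    (unorm sigma u 1 ^+ 2 / (\dim {:F})%:R) ^+ \dim {:F}.
  rewrite unorm1_sqr // -(card_index sigmaP).
  have := leif_AGM (A := predT) (E := fun k => weight u k ^+ 2) _.
  by move=> /(_ (fun k _ => ltW (w_gt0 k))) [].
have unorm1_gt0 : 0 < unorm sigma u 1 ^+ 2.
  have /card_gt0P [k _] : (0 < #|{: 'I_r1 + ('I_r2 + 'I_r2)}|)%N.
    by rewrite (card_index sigmaP).
  rewrite unorm1_sqr // (bigD1 k) //= ltr_pwDl ?w_gt0 //.
  by apply: sumr_ge0 => l _; apply/ltW/w_gt0.
have P_gt0 : 0 < \prod_k weight u k ^+ 2 by apply: prodr_gt0 => k _.
have := index_bound m n_gt0 P_gt0 disc_gt0 unorm1_gt0
  agm (det_lattice_mx sigmaP u e) (hermite_constant_ge sigmaP eF IE u_gt0 min1).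
have -> : m%:R ^+ 2 * `|ratr (basis_discriminant e)| =
    `|ratr (field_discriminant F)| :> R.
  by rewrite discE rmorphM rmorphXn /= ratr_nat [RHS]normrM normrX normr_nat.
move=> /le_lt_trans /(_ lt_norm).
by rewrite -(ratr_nat R m) ltr_rat ltNge norm_le.
Qed.
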